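(* Let $n\geq 1$. The average weight of the Delannoy--Steinhaus triangles over all $2^n$ binary sequences of length $n$ is \[ \frac{1}{2^n}\sum_{X\in(\mathbb{Z}/2\mathbb{Z})^n}|D(X)|=\frac{1}{2}\binom{n+1}{2}. \]
   Context: For $X=(a_0,\ldots,a_{n-1})\in(\mathbb{Z}/2\mathbb{Z})^n$, the (binary) Delannoy--Steinhaus triangle $D(X)=(a_{i,j})$ is defined for $0\leq i\leq n-1$ and $0\leq j\leq n-i-1$ by $a_{0,j}=a_j$ and, in $\mathbb{Z}/2\mathbb{Z}$, \[ a_{1,j}=a_{0,j}+a_{0,j+1}\quad(0\leq j\leq n-2), \] \[ a_{i+1,j}=a_{i,j}+a_{i,j+1}+a_{i-1,j+1}\quad(1\leq i\leq n-2,\ 0\leq j\leq n-i-2). \] The weight $|D(X)|$ is the number of entries $a_{i,j}$ of the triangle (all rows, including row $0$) equal to $1$. *)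

(* Defs.v *)
From HB Require Import structures.
From mathcomp Require Import all_boot all_order all_algebra.

Set Implicit Arguments.
Unset Strict Implicit.
Unset Printing Implicit Defensive.

Import GRing.Theory.
Local Open Scope ring_scope.

(* The recurrence is run on an infinite row a. The entry (i, j) depends only on
   a j, ..., a (j + i), so for a sequence of length n the padding beyond index
   n - 1 never reaches the entries with i + j < n. *)
Fixpoint ds_entry (a : nat -> 'Z_2) (i j : nat) {struct i} : 'Z_2 :=
  match i with
  | 0%N => a j
  | i1.+1 =>
      match i1 with
      | 0%N => a j + a j.+1
      | i2.+1 => ds_entry a i1 j + ds_entry a i1 j.+1 + ds_entry a i2 j.+1
      end
  end.

(* For i < n, the range 0 <= j <= n - i - 1 is i + j < n. *)
Definition ds_domain (n : nat) : {set 'I_n * 'I_n} :=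
  [set ij : 'I_n * 'I_n | (ij.1 + ij.2 < n)%N].

Definition ds_triangle (n : nat) (X : n.-tuple 'Z_2) (i j : nat) : 'Z_2 :=
  ds_entry (nth 0 X) i j.

Definition ds_weight (n : nat) (X : n.-tuple 'Z_2) : nat :=
  #|[set ij in ds_domain n | ds_triangle X ij.1 ij.2 == 1]|.

(* Main.v *)
Require Import Defs.
From HB Require Import structures.
From mathcomp Require Import all_boot all_order all_algebra.

(** Summing weights over all sequences amounts to counting, for each position
    (i, j) of the triangle, the sequences X whose entry there is 1. In the
    recurrence for entry (i, j) one summand sits in column j and all others in
    column j + 1, and an entry never depends on generators to the left of its
    own column. Hence, by induction on i, the generator a_j occurs in
    entry (i, j) with coefficient exactly 1 ([ds_entry_add1]): toggling a_j is
    an involution of the set of sequences which changes that entry. So exactly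
    half of the 2^n sequences have a 1 at (i, j) ([ds_triangle_half]), and the
    average weight is half of the number 'C(n+1, 2) of positions. *)

Set Implicit Arguments.
Unset Strict Implicit.
Unset Printing Implicit Defensive.

Import GRing.Theory.
Local Open Scope ring_scope.

(** The recurrence refers to the two preceding rows, so the induction on the
    row carries the claim for two consecutive rows at once. *)
Lemma eq_ds_entry (a b : nat -> 'Z_2) (i j : nat) :
  (forall k, (j <= k)%N -> a k = b k) -> ds_entry a i j = ds_entry b i j.
Proof.
move=> eq_ab; suff: forall l, (j <= l)%N ->
    ds_entry a i l = ds_entry b i l /\ ds_entry a i.+1 l = ds_entry b i.+1 l.
  by case/(_ j (leqnn j)).
elim: i => [|i IHi] l le_jl; first by rewrite /= !eq_ab // leqW.
have [_ eq_l] := IHi _ le_jl; have [eq_l2 eq_l1] := IHi _ (leqW le_jl).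
split=> //; change (ds_entry a i.+1 l + ds_entry a i.+1 l.+1 + ds_entry a i l.+1
  = ds_entry b i.+1 l + ds_entry b i.+1 l.+1 + ds_entry b i l.+1).
by rewrite eq_l eq_l1 eq_l2.
Qed.

(** Only the summand in column j of the recurrence sees the change at j, the
    others lying in column j + 1, from which on a and b agree; so the induction
    on the row involves only the preceding row. *)
Lemma ds_entry_add1 (a b : nat -> 'Z_2) (i j : nat) :
    b j = a j + 1 -> (forall k, (j < k)%N -> b k = a k) ->
  ds_entry b i j = ds_entry a i j + 1.
Proof.
move=> b_j eq_ba; elim: i => [//|[|i] IHi].
  by rewrite /= b_j eq_ba // addrAC.
change (ds_entry b i.+1 j + ds_entry b i.+1 j.+1 + ds_entry b i j.+1
  = ds_entry a i.+1 j + ds_entry a i.+1 j.+1 + ds_entry a i j.+1 + 1).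
by rewrite IHi !(eq_ds_entry _ eq_ba) -!addrA (addrC 1) -!addrA.
Qed.

Definition toggle (n : nat) (j : 'I_n) (X : n.-tuple 'Z_2) : n.-tuple 'Z_2 :=
  [tuple tnth X k + (k == j)%:R | k < n].

Lemma toggleK (n : nat) (j : 'I_n) : involutive (toggle j).
Proof.
move=> X; apply: eq_from_tnth => k; rewrite !tnth_mktuple -addrA.
by case: (k == j); apply: val_inj; case: (tnth X k) => [[|[|]]].
Qed.

Lemma ds_triangle_toggle (n : nat) (X : n.-tuple 'Z_2) (i : nat) (j : 'I_n) :
  ds_triangle (toggle j X) i j = ds_triangle X i j + 1.
Proof.
apply: ds_entry_add1 => [|k lt_jk].
  by rewrite -!tnth_nth tnth_mktuple eqxx.
(* Beyond index n - 1 both infinite rows carry the padding 0. *)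
have [lt_kn|le_nk] := ltnP k n; last by rewrite !nth_default ?size_tuple.
rewrite -[k]/(val (Ordinal lt_kn)) -!tnth_nth tnth_mktuple.
by rewrite -val_eqE /= gtn_eqF // addr0.
Qed.

Lemma ds_triangle_half (n : nat) (i : nat) (j : 'I_n) :
  (2 * \sum_(X : n.-tuple 'Z_2) (ds_triangle X i j == 1%R) = 2 ^ n)%N.
Proof.
rewrite mul2n -addnn {2}(reindex_inj (inv_inj (toggleK j))) -big_split /=.
rewrite -[RHS](_ : #|{: n.-tuple 'Z_2}| = _); last by rewrite card_tuple card_ord.
rewrite -sum1_card; apply: eq_bigr => X _; rewrite ds_triangle_toggle.
by case: (ds_triangle X i j) => [[|[|]]].
Qed.

Lemma card_ds_domain (n : nat) : #|ds_domain n| = 'C(n.+1, 2).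
Proof.
rewrite -sum1_card (eq_bigl (fun ij : 'I_n * 'I_n => true && (ij.1 + ij.2 < n)%N)) => [|ij].
  rewrite -(pair_big_dep xpredT (fun i j : 'I_n => i + j < n)%N (fun _ _ => 1%N)).
  (* Row i has n - i entries; reversing the rows gives 1 + 2 + ... + n. *)
  rewrite -bin2_sum big_nat_recl // add0n big_mkord [RHS](reindex_inj rev_ord_inj) /=.
  apply: eq_bigr => i _; rewrite subnSK // -[RHS]card_ord -sum1_card.
  rewrite (big_ord_widen n (fun=> 1%N)) ?leq_subr //.
  by apply: eq_bigl => j; rewrite ltn_subRL.
by rewrite inE.
Qed.

Lemma sum_ds_weight (n : nat) :
  (2 * \sum_(X : n.-tuple 'Z_2) ds_weight X = 2 ^ n * 'C(n.+1, 2))%N.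
Proof.
under eq_bigr => X _.
  rewrite /ds_weight -sum1dep_card big_mkcondr; over.
rewrite exchange_big big_distrr /= -card_ds_domain mulnC -sum_nat_const.
apply: eq_bigr => ij _; rewrite -(ds_triangle_half ij.1 ij.2).
by congr (2 * _)%N; apply: eq_bigr => X _; case: (_ == _).
Qed.

Theorem theorem5p1 (n : nat) (hn : (1 <= n)%N) :
  1 / 2 ^+ n * \sum_(X : n.-tuple 'Z_2) (ds_weight X)%:R
  = 1 / 2 * 'C(n.+1, 2)%:R :> rat.
Proof.
have nz2 : (2 : rat) != 0 by [].
apply: (mulfI nz2); rewrite -natr_sum mulrCA -natrM sum_ds_weight natrM natrX.
by rewrite !mul1r mulKf ?expf_neq0 // mulVKf.
Qed.
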